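(* If $G$ is a graph that is not complete and has $\mathrm{diam}(G)\le 3$, then $$n(G)+\mu_o(G)\le \mu(M(G))\le n(G)+\mu(G)+1.$$ Moreover, if $\mu(M(G))=n(G)+\mu(G)+1$, then every $\mu$-set of $M(G)$ contains $v^*$.
   Context: All graphs are finite and simple; $n(G)$ is the order of $G$ and $\mathrm{diam}(G)$ its diameter. The Mycielskian $M(G)$ has vertex set $V(G)\cup V(G')\cup\{v^*\}$, where $V(G')=\{u': u\in V(G)\}$, and edge set $E(G)\cup\{uv': uv\in E(G)\}\cup\{v'v^*: v'\in V(G')\}$. Given $S\subseteq V(H)$, two vertices $x,y$ of $H$ are $S$-visible if some shortest $x,y$-path in $H$ has no internal vertex in $S$. $S$ is a mutual-visibility set if every two vertices of $S$ are $S$-visible; $\mu(H)$ is the maximum size of such a set, and a mutual-visibility set of that size is a $\mu$-set. $S$ is an outer mutual-visibility set if it is a mutual-visibility set and moreover every pair $u\in S$, $v\in V(H)\setminus S$ is $S$-visible; $\mu_o(H)$ is the maximum size of such a set. *)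

(* Defs.v *)
From mathcomp Require Import all_boot.

Set Implicit Arguments.
Unset Strict Implicit.
Unset Printing Implicit Defensive.

Record sgraph := SGraph {
  vertex :> finType;
  edge : rel vertex;
  edge_sym : symmetric edge;
  edge_irrefl : irreflexive edge }.

Arguments edge {s}.

Section Distance.
Variable G : sgraph.
Implicit Types (x y : G) (p : seq G).

Definition complete : Prop := forall x y, x != y -> edge x y.

(* The path is [x :: p], so [size p] is its number of edges. *)
Definition is_path x y p : bool :=
  [&& path edge x p, last x p == y & uniq (x :: p)].

Definition internal x p : seq G := behead (belast x p).

(* A path has fewer than [#|G|] edges; [None] stands for infinity. *)
Definition dist x y : option nat :=
  ohead [seq k <- iota 0 #|G| | [exists p : k.-tuple G, is_path x y p]].

(* [None] stands for infinity: the graph is disconnected. *)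
Definition diam : option nat :=
  if [forall x, forall y, isSome (dist x y)]
  then Some (\max_(x : G) \max_(y : G) odflt 0 (dist x y))
  else None.

Definition shortest_path x y p : bool :=
  is_path x y p && (dist x y == Some (size p)).

End Distance.

Section Visibility.
Variable G : sgraph.
Implicit Types (x y : G) (S : {set G}).

(* The bound [k < #|G|] is no restriction; see [visibleP]. *)
Definition visible S x y : bool :=
  [exists k : 'I_#|G|, exists p : k.-tuple G,
     shortest_path x y p && all (fun z => z \notin S) (internal x p)].

Lemma visibleP S x y :
  reflect (exists2 p : seq G, shortest_path x y p &
             forall z, z \in internal x p -> z \notin S)
          (visible S x y).
Proof.
apply: (iffP existsP) => [[k /existsP[p /andP[sp /allP ip]]]|[p sp ip]].
  by exists p.
have lt_p : size p < #|G|.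
  case/andP: sp => /and3P[_ _ up] _.
  by rewrite -[(size p).+1]/(size (x :: p)) -(card_uniqP up) max_card.
exists (Ordinal lt_p); apply/existsP; exists (in_tuple p).
by rewrite sp; apply/allP.
Qed.

Definition mutual_visibility S : bool :=
  [forall x in S, forall y in S, (x != y) ==> visible S x y].

Definition outer_mutual_visibility S : bool :=
  mutual_visibility S && [forall u in S, forall v in ~: S, visible S u v].

Definition mu : nat := \max_(S : {set G} | mutual_visibility S) #|S|.

Definition mu_o : nat := \max_(S : {set G} | outer_mutual_visibility S) #|S|.

Definition mu_set S : bool := mutual_visibility S && (#|S| == mu).

End Visibility.

Section Mycielskian.
Variable G : sgraph.

(* [inl (inl u)] is u, [inl (inr u)] is u' and [inr tt] is v*. *)
Definition myc_edge : rel (G + G + unit) := fun x y =>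
  match x, y with
  | inl (inl u), inl (inl v) => edge u v
  | inl (inl u), inl (inr v) => edge u v
  | inl (inr u), inl (inl v) => edge u v
  | inl (inr _), inr _ => true
  | inr _, inl (inr _) => true
  | _, _ => false
  end.

Lemma myc_edge_sym : symmetric myc_edge.
Proof. by move=> [[u|u]|u] [[v|v]|v] //=; apply: edge_sym. Qed.

Lemma myc_edge_irrefl : irreflexive myc_edge.
Proof. by move=> [[u|u]|u] //=; apply: edge_irrefl. Qed.

Definition mycielskian : sgraph := SGraph myc_edge_sym myc_edge_irrefl.

Definition vstar : mycielskian := inr tt.

End Mycielskian.

(* Main.v *)
(** Since [diam G <= 3], a shortest path of [M(G)] between two vertices of [G]
    avoids [v*], and forgetting the primes turns it into a shortest path of [G].

    Lower bound: if [S] is outer mutual-visible in [G], then [S] together with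
    all the copies [u'] is mutual-visible in [M(G)].  A vertex [u] of [S] sees
    its own copy [u'] because some neighbour of [u] is outside [S]: otherwise
    [u] would be universal and [S] would be all of [G], forcing [G] complete.

    Upper bound: if [S] is mutual-visible in [M(G)], then the set of all [u]
    with both [u] and [u'] in [S] is mutual-visible in [G], and it has at least
    [#|S :\ v*| - #|G|] elements. *)

Require Import Defs.
From mathcomp Require Import all_boot.

Set Implicit Arguments.
Unset Strict Implicit.
Unset Printing Implicit Defensive.

(** * Walks, distances and visibility in an arbitrary graph *)

Section Walks.
Context {G : sgraph}.
Implicit Types (x y : G) (p q : seq G) (S : {set G}).

Lemma dist_SomeP x y k :
  reflect [/\ exists2 p, is_path x y p & size p = k
            & forall p, is_path x y p -> k <= size p]
          (dist x y == Some k).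
Proof.
have exP j : reflect (exists2 p, is_path x y p & size p = j)
                     [exists p : j.-tuple G, is_path x y p].
  apply: (iffP existsP) => [[p xyp]|[p xyp <-]]; last by exists (in_tuple p).
  by exists p; rewrite ?size_tuple.
have ltn_card p : is_path x y p -> size p < #|G|.
  case/and3P=> _ _ up.
  by rewrite -[(size p).+1]/(size (x :: p)) -(card_uniqP up) max_card.
(* The start [m] is arbitrary because the induction on [n] advances it; [dist] is the case
   [m = 0]. *)
have firstP (P : pred nat) m n :
    reflect [/\ m <= k < m + n, P k & forall j, m <= j -> P j -> k <= j]
            (ohead [seq j <- iota m n | P j] == Some k).
  elim: n m => [|n IHn] m /=.
    by apply: ReflectF => -[/andP[mk]]; rewrite addn0 ltnNge mk.
  case Pm: (P m) => /=.
    apply: (iffP eqP) => [[<-]|[/andP[mk _] _ /(_ m (leqnn m) Pm) km]].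
      by rewrite leqnn addnS ltnS leq_addr.
    by congr Some; apply/eqP; rewrite eqn_leq mk.
  apply: (iffP (IHn m.+1)); rewrite addSnnS => -[/andP[mk kn] Pk kmin].
    split=> // [|j]; first by rewrite (ltnW mk).
    by rewrite leq_eqVlt => /orP[/eqP <-|/kmin//]; rewrite Pm.
  split=> // [|j /ltnW/kmin//].
  rewrite kn andbT ltn_neqAle mk andbT; apply: contraFneq Pm => ->.
  exact: Pk.
apply: (iffP (firstP _ 0 #|G|)) => [[_ /exP exk kmin]|[exk kmin]].
  by split=> // p xyp; apply: kmin => //; apply/exP; exists p.
split=> [||j _ /exP[p xyp <-]]; [|exact/exP|exact: kmin].
by case: exk => p /ltn_card ltp <-.
Qed.

(** Cutting cycles out of a walk never lengthens it, so competing with paths or with all walks is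
    the same. Projected walks, which may repeat vertices, thus become legitimate competitors. *)
Lemma shortest_pathP x y p :
  reflect [/\ path edge x p, last x p = y
            & forall q, path edge x q -> last x q = y -> size p <= size q]
          (shortest_path x y p).
Proof.
have shortenW q : path edge x q -> last x q = y ->
    exists q', [/\ is_path x y q', size q' <= size q & {subset q' <= q}].
  case/shortenP=> q' eq' uq' sq' lq'; exists q'.
  split=> //; first by apply/and3P; split=> //; apply/eqP.
  by case/andP: uq' => _ uq'; apply: uniq_leq_size.
apply: (iffP andP) => [[/and3P[ep /eqP lp _] /dist_SomeP[_ pmin]]|[ep lp pmin]].
  split=> // q eq lq; have [q' [xyq' leq _]] := shortenW q eq lq.
  exact: leq_trans (pmin q' xyq') leq.
have xyp : is_path x y p.
  apply/and3P; split=> //; first exact/eqP.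
  (* The shortened walk is repetition-free, stays within [x :: p] and by minimality is no shorter,
     so [x :: p] has no repetition either. *)
  have [q [/and3P[eq /eqP lq uq] _ sqp]] := shortenW p ep lp.
  apply: (leq_size_uniq uq) => [z|]; last by rewrite /= ltnS pmin.
  by rewrite !inE => /orP[->|/sqp->] //; rewrite orbT.
split=> //; apply/dist_SomeP; split=> [|q /and3P[eq /eqP lq _]].
  by exists p.
exact: pmin.
Qed.

(** Here [q] holds exactly the internal vertices, so the path has [(size q).+1] edges and minimality
    becomes a strict inequality. *)
Lemma visible_walkP S x y : x != y ->
  reflect (exists q, [/\ path edge x (rcons q y), {in q, forall z, z \notin S}
             & forall r, path edge x r -> last x r = y -> size q < size r])
          (visible S x y).
Proof.
have internal_rcons q z : internal x (rcons q z) = q.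
  by rewrite /internal belast_rcons.
move=> neq_xy; apply: (iffP (visibleP S x y)).
  case=> p /shortest_pathP[]; case/lastP: p => [_ /= eq_xy|q z].
    by rewrite eq_xy eqxx in neq_xy.
  rewrite last_rcons size_rcons internal_rcons => eq eq_zy qmin nSq.
  by exists q; rewrite -{1}eq_zy.
case=> q [eq nSq qmin]; exists (rcons q y); last by rewrite internal_rcons.
by apply/shortest_pathP; rewrite last_rcons size_rcons.
Qed.

Lemma walk_rev x y p : path edge x p -> last x p = y ->
  path edge y (rev (belast x p)) /\ last y (rev (belast x p)) = x.
Proof.
move=> ep <-; split; last by case: p {ep} => //= z p; rewrite rev_cons last_rcons.
by rewrite rev_path; under eq_path do rewrite edge_sym.
Qed.

Lemma visible_sym S x y : x != y -> visible S x y = visible S y x.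
Proof.
wlog suff sub: x y / x != y -> visible S x y -> visible S y x.
  by move=> nxy; apply/idP/idP; apply: sub; rewrite // eq_sym.
move=> nxy /(visible_walkP S nxy)[q [eq nSq qmin]].
rewrite eq_sym in nxy; apply/(visible_walkP S nxy); exists (rev q); split.
- have [] := walk_rev eq (last_rcons _ _ _).
  by rewrite belast_rcons rev_cons.
- by move=> z; rewrite mem_rev => /nSq.
- move=> r er lr; have [er' lr'] := walk_rev er lr.
  by have := qmin _ er' lr'; rewrite !size_rev size_belast.
Qed.

(** The endpoints are at distance two, so the path through [y] is shortest. *)
Lemma visible_via S x y z : x != z -> ~~ edge x z -> edge x y -> edge y z ->
  y \notin S -> visible S x z.
Proof.
move=> nxz nexz xy yz nSy; apply/(visible_walkP _ nxz); exists [:: y].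
split=> [|w|]; first by rewrite /= xy yz.
  by rewrite inE => /eqP->.
case=> [|a [|b r]] //= => [_ exz|/andP[exa _] eaz].
  by rewrite exz eqxx in nxz.
by rewrite -eaz exa in nexz.
Qed.

Lemma mutual_visibilityP S :
  reflect {in S &, forall x y, x != y -> visible S x y} (mutual_visibility S).
Proof.
apply: (iffP forall_inP) => [vS x y xS yS|vS x xS].
  by have /forall_inP/(_ y yS)/implyP := vS x xS.
by apply/forall_inP => y yS; apply/implyP; apply: vS.
Qed.

(** No vertex is left to be internal, so the witnessing paths are single edges. *)
Lemma mutual_visibilityT : mutual_visibility [set: G] -> complete G.
Proof.
move=> /mutual_visibilityP vT x y nxy.
have /(visible_walkP _ nxy)[q [eq nTq _]] := vT x y (in_setT x) (in_setT y) nxy.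
case: q eq nTq => [|z q _ /(_ z (mem_head z q))]; last by rewrite in_setT.
by rewrite /= andbT.
Qed.

Lemma leq_mu S : mutual_visibility S -> #|S| <= mu G.
Proof. by move=> vS; exact: (leq_bigmax_cond (F := fun T : {set G} => #|T|)). Qed.

Lemma mu_o_witness : exists2 S : {set G}, outer_mutual_visibility S & #|S| = mu_o G.
Proof.
have v0 : outer_mutual_visibility (set0 : {set G}).
  apply/andP; split; first by apply/mutual_visibilityP => x y; rewrite inE.
  by apply/forall_inP => x; rewrite inE.
have pos : 0 < #|[pred S : {set G} | outer_mutual_visibility S]|.
  by apply/card_gt0P; exists set0.
have [S vS eqS] := eq_bigmax_cond (fun T : {set G} => #|T|) pos.
by exists S; rewrite // /mu_o -eqS.
Qed.

Lemma diam_walk d x y : diam G = Some d ->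
  exists p, [/\ path edge x p, last x p = y & size p <= d].
Proof.
rewrite /diam; case: ifP => // /forallP/(_ x)/forallP/(_ y).
case dxy: (dist x y) => [k|//] _ [<-].
have /dist_SomeP[[p /and3P[ep /eqP lp _] sp] _] := introT eqP dxy.
exists p; split=> //; rewrite sp -[k]/(odflt 0 (Some k)) -dxy.
apply: leq_trans (leq_bigmax x).
exact: (leq_bigmax (F := fun z => odflt 0 (dist x z))).
Qed.

Lemma outer_visibility_neighbor S x :
  ~ complete G -> (exists d, diam G = Some d) ->
  outer_mutual_visibility S -> x \in S -> exists2 y, edge x y & y \notin S.
Proof.
move=> ncG [d diamG] /andP[vS /forall_inP oS] xS.
have [[y xy nSy]|noy] := altP (exists_inP (D := edge x) (P := fun y => y \notin S)).
  by exists y.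
have nbS y : edge x y -> y \in S.
  by move=> xy; apply: contraR noy => nSy; apply/exists_inP; exists y.
suff ST : S = [set: G] by case: ncG; apply: mutual_visibilityT; rewrite -ST.
apply/setP => y; rewrite in_setT; apply: contraT => nSy.
have nxy : x != y by apply: contraNneq nSy => <-.
have /forall_inP/(_ y) := oS x xS; rewrite inE => /(_ nSy).
(* The vertex following [x] is a neighbour, hence in [S]; yet it is either [y] or an internal
   vertex, both outside [S]. *)
case/(visible_walkP _ nxy) => -[|z q] [/= /andP[xz _] nSq _].
  by rewrite nbS in nSy.
by have := nSq z (mem_head z q); rewrite nbS.
Qed.

End Walks.

(** * Walks and visibility in the Mycielskian *)

Section MycielskianVisibility.
Variable G : sgraph.
Implicit Types (u v : G) (p : seq (mycielskian G)).

Local Notation M := (mycielskian G).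
Local Notation base u := (inl (inl u) : M).
Local Notation copy u := (inl (inr u) : M).

(* [u0] is the junk value of the projection at [v*]. *)
Definition myc_proj u0 (z : M) : G :=
  match z with inl (inl u) => u | inl (inr u) => u | inr _ => u0 end.

Definition base_part (S : {set M}) : {set G} := [set u | base u \in S].
Definition copy_part (S : {set M}) : {set G} := [set u | copy u \in S].

Lemma card_myc_set (S : {set M}) :
  #|S| = #|base_part S| + #|copy_part S| + (vstar G \in S).
Proof.
rewrite -!sum1_card big_mkcond big_sumType big_sumType /=.
congr (_ + _ + _).
- by rewrite [RHS]big_mkcond; apply: eq_bigr => u _; rewrite inE.
- by rewrite [RHS]big_mkcond; apply: eq_bigr => u _; rewrite inE.
- by rewrite (bigD1 tt) //= big1 ?addn0 => [|[]//]; case: (_ \in S).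
Qed.

(** Away from [vstar G], every edge of [M] lies over an edge of [G]. *)
Lemma proj_walk u0 (x : M) p : vstar G \notin x :: p -> path edge x p ->
  path edge (myc_proj u0 x) (map (myc_proj u0) p).
Proof.
elim: p x => //= y p IHp x; rewrite inE negb_or => /andP[nx nyp].
case/andP=> xy /(IHp y nyp) ->; rewrite andbT.
move: nyp; rewrite inE negb_or => /andP[ny _].
by case: x y nx ny xy => [[u|u]|[]] [[v|v]|[]].
Qed.

(** Only copies are adjacent to [vstar G], so reaching it from a base vertex costs two edges, and so
    does returning. *)
Lemma vstar_walk_base u v p : path edge (base u) p -> last (base u) p = base v ->
  vstar G \in p -> 3 < size p.
Proof.
by case: p => [|[[a|a]|[]] [|[[b|b]|[]] [|[[c|c]|[]] [|d p]]]] //=;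
  rewrite ?andbF.
Qed.

Lemma vstar_walk_copy u v p : path edge (base u) p -> last (base u) p = copy v ->
  vstar G \in p -> 2 < size p.
Proof. by case: p => [|[[a|a]|[]] [|[[b|b]|[]] [|c p]]] //=; rewrite ?andbF. Qed.

Lemma map_base_walk u (q : seq G) :
  path edge (base u) [seq base w | w <- q] = path edge u q.
Proof. by elim: q u => //= v q IHq u; rewrite IHq. Qed.

Context (diam_le3 : exists2 d : nat, diam G = Some d & d <= 3).

(** Applied with [n = (size q).+1] to the minimality clause of [visible_walkP]. *)
Lemma shortest_size_le3 u v n :
  (forall q : seq G, path edge u q -> last u q = v -> n <= size q) -> n <= 3.
Proof.
case: diam_le3 => d diamG led nmin.
have [p [ep lp sp]] := diam_walk u v diamG.
exact: leq_trans (nmin p ep lp) (leq_trans sp led).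
Qed.

Lemma visible_myc_base (S : {set M}) u v : u != v ->
  visible (base_part S) u v -> visible S (base u) (base v).
Proof.
move=> nuv /(visible_walkP _ nuv)[q [eq nSq qmin]].
have nuvM : base u != base v by [].
apply/(visible_walkP _ nuvM); exists [seq base w | w <- q]; split.
- by rewrite -map_rcons map_base_walk.
- by move=> _ /mapP[w /nSq + ->]; rewrite inE.
move=> r er lr; rewrite size_map.
have [vr|nvr] := boolP (vstar G \in r).
  exact: leq_trans (shortest_size_le3 qmin) (ltnW (vstar_walk_base er lr vr)).
rewrite -(size_map (myc_proj u)).
apply: qmin; first exact: (proj_walk u (x := base u)).
by rewrite -[u in last u _]/(myc_proj u (base u)) last_map lr.
Qed.

(** Only the last vertex of the path in [G] gets primed. A detour through [vstar G] now has at least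
    three edges, just enough not to beat a path of length at most three. *)
Lemma visible_myc_copy (S : {set M}) u v : u != v ->
  visible (base_part S) u v -> visible S (base u) (copy v).
Proof.
move=> nuv /(visible_walkP _ nuv)[q [eq nSq qmin]].
have nuvM : base u != copy v by [].
apply/(visible_walkP _ nuvM); exists [seq base w | w <- q]; split.
- move: eq; rewrite !rcons_path map_base_walk => /andP[-> /=].
  by rewrite -[base u]/((fun w => base w) u) last_map.
- by move=> _ /mapP[w /nSq + ->]; rewrite inE.
move=> r er lr; rewrite size_map.
have [vr|nvr] := boolP (vstar G \in r).
  exact: leq_trans (shortest_size_le3 qmin) (vstar_walk_copy er lr vr).
rewrite -(size_map (myc_proj u)).
apply: qmin; first exact: (proj_walk u (x := base u)).
by rewrite -[u in last u _]/(myc_proj u (base u)) last_map lr.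
Qed.

Lemma mu_mycielskian_lb : ~ complete G -> #|G| + mu_o G <= mu M.
Proof.
move=> ncG; have [S oS <-] := mu_o_witness (G := G).
have [vS outS] := andP oS.
(* Leaving out [vstar G] lets it serve as the internal vertex between any two copies. *)
pose T : {set M} :=
  [set z | match z with
           | inl (inl u) => u \in S | inl (inr _) => true | inr _ => false
           end].
have TS : base_part T = S by apply/setP => u; rewrite !inE.
have cT : copy_part T = [set: G] by apply/setP => u; rewrite !inE.
have <- : #|T| = #|G| + #|S|.
  by rewrite card_myc_set TS cT cardsT inE addn0 addnC.
have base_copy u v : u \in S -> visible T (base u) (copy v).
  move=> uS; have [<-|nuv] := eqVneq u v.
    have [|w uw nSw] := outer_visibility_neighbor ncG _ oS uS.
      by case: diam_le3 => d; exists d.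
    apply: (@visible_via M T (base u) (base w) (copy u)) => //=.
    - by rewrite edge_irrefl.
    - by rewrite edge_sym.
    - by rewrite inE.
  apply: visible_myc_copy; rewrite ?TS //.
  (* All copies lie in [T], even those of vertices [v] outside [S]: here outer visibility is
     needed. *)
  have [vinS|nSv] := boolP (v \in S); first exact: (mutual_visibilityP _ vS).
  by have /forall_inP/(_ u uS)/forall_inP := outS; apply; rewrite inE.
apply: leq_mu; apply/mutual_visibilityP.
case=> [[u|u]|[]] [[v|v]|[]]; rewrite !inE //= => uS vinS nuv.
- by apply: visible_myc_base; rewrite ?TS //; apply: (mutual_visibilityP _ vS).
- exact: base_copy.
- by rewrite visible_sym // base_copy.
- by apply: (@visible_via M T (copy u) (vstar G) (copy v)) => //; rewrite inE.
Qed.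

Lemma mutual_visibility_double (S : {set M}) : mutual_visibility S ->
  mutual_visibility (base_part S :&: copy_part S).
Proof.
move=> /mutual_visibilityP vS; apply/mutual_visibilityP => u v.
rewrite !inE => /andP[uS _] /andP[vinS _] nuv.
have nuvM : base u != base v by [].
have /(visible_walkP _ nuvM)[q [eq nSq qmin]] := vS _ _ uS vinS nuvM.
have minG (p : seq G) : path edge u p -> last u p = v -> size q < size p.
  move=> ep lp; rewrite -(size_map (fun w => base w)).
  apply: qmin; first by rewrite map_base_walk.
  by rewrite -[base u]/((fun w => base w) u) last_map lp.
(* Walks of [G] lift to [M], so this shortest path has at most three edges, too few to visit
   [vstar G]. *)
have nvq : vstar G \notin rcons q (base v).
  apply: contraL (shortest_size_le3 minG) => vq.
  rewrite -ltnNge -(size_rcons q (base v)).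
  by apply: (vstar_walk_base (u := u) (v := v)); rewrite ?last_rcons.
apply/(visible_walkP _ nuv); exists (map (myc_proj u) q); split.
- have := proj_walk u (x := base u) nvq eq.
  by rewrite map_rcons.
(* An internal vertex may be [w] or its copy; either one missing from [S] keeps [w] out of the
   intersection. *)
- move=> _ /mapP[z zq ->]; have := nSq z zq; rewrite !inE negb_and.
  case: z zq => [[w|w]|[]] zq /= nSw; rewrite ?nSw ?orbT //.
  by move: nvq; rewrite mem_rcons inE zq orbT.
- by move=> r er lr; rewrite size_map minG.
Qed.

(** The two parts have a union of size at most [#|G|] and an intersection of size at most [mu G]. *)
Lemma card_myc_mutual_visibility (S : {set M}) : mutual_visibility S ->
  #|S| <= #|G| + mu G + (vstar G \in S).
Proof.
move=> /mutual_visibility_double/leq_mu leC; rewrite card_myc_set leq_add2r.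
by rewrite -cardsUI leq_add // max_card.
Qed.

End MycielskianVisibility.

Unset Implicit Arguments.

Theorem theorem5p4 (G : sgraph) (not_complete : ~ complete G)
    (diam_le3 : exists2 d : nat, diam G = Some d & d <= 3) :
  (#|G| + mu_o G <= mu (mycielskian G) <= #|G| + mu G + 1) /\
  (mu (mycielskian G) = #|G| + mu G + 1 ->
   forall S : {set mycielskian G}, mu_set S -> vstar G \in S).
Proof.
split=> [|muE S /andP[vS /eqP cS]].
  rewrite mu_mycielskian_lb //; apply/bigmax_leqP => S vS.
  apply: leq_trans (card_myc_mutual_visibility diam_le3 vS) _.
  by rewrite leq_add2l leq_b1.
(* At the extreme value, the bound leaves [1 <= (vstar G \in S)]. *)
have := card_myc_mutual_visibility diam_le3 vS.
by rewrite cS muE leq_add2l lt0b.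
Qed.
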